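(* Let $n$ be a positive integer, let $p > 3$ be a prime number, and let $\varphi_1,\dots,\varphi_n \in \mathbb{Z}_p[[x_1,\dots,x_n]]$ be power series convergent on $\mathbb{Z}_p^n$ such that for each $i = 1,\dots,n$: (a) $\varphi_i(x_1,\dots,x_n) \equiv x_i \pmod{p}$ (i.e., all coefficients of $\varphi_i - x_i$ lie in $p\mathbb{Z}_p$); and (b) for all $k_1,\dots,k_n \in \mathbb{N}$ with $k_1+\dots+k_n \ge 2$, the coefficient of $x_1^{k_1}\cdots x_n^{k_n}$ in $\varphi_i$ lies in $p^{k_1+\dots+k_n-1}\mathbb{Z}_p$. Let $(\omega_1,\dots,\omega_n) \in \mathbb{Z}_p^n$. Then there exist $p$-adic analytic functions $f_1,\dots,f_n \in \mathbb{Q}_p[[z]]$ such that for each $i = 1,\dots,n$: (1) $f_i$ converges for $|z|_p \le 1$; (2) $f_i(0) = \omega_i$; (3) $|f_i(z)|_p \le 1$ for $|z|_p \le 1$; and (4) $f_i(z+1) = \varphi_i(f_1(z),\dots,f_n(z))$.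
   Context: $|\cdot|_p$ is the usual absolute value on $\mathbb{Q}_p$ with $|p|_p = 1/p$; $\mathbb{N}$ denotes the nonnegative integers. *)

(* Defs.v *)
From HB Require Import structures.
From mathcomp Require Import all_boot all_order all_algebra finmap.
From mathcomp Require Import fraction.
From mathcomp Require Import all_classical.
From mathcomp Require Import topology sequences.

Set Implicit Arguments.
Unset Strict Implicit.
Unset Printing Implicit Defensive.

Import Order.TTheory GRing.Theory Num.Theory.

Local Open Scope classical_set_scope.
Local Open Scope ring_scope.

Lemma Zp_nat_eq0 d k : (1 < d)%N -> (k%:R == 0 :> 'Z_d) = (d %| k)%N.
Proof. by move=> d_gt1; rewrite -val_eqE -[val _]/(nat_of_ord _) val_Zp_nat. Qed.

Section Reduction.
Variables (m d : nat).
Hypotheses (d_gt1 : (1 < d)%N) (m_gt1 : (1 < m)%N) (d_dvd_m : (d %| m)%N).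

Definition Zp_red (a : 'Z_m) : 'Z_d := (a : nat)%:R.

Lemma Zp_red_nat k : Zp_red k%:R = k%:R.
Proof.
rewrite /Zp_red val_Zp_nat // -[LHS]Zp_nat_mod // modn_dvdm //.
exact: Zp_nat_mod.
Qed.

Lemma Zp_red1 : Zp_red 1 = 1. Proof. exact: (Zp_red_nat 1). Qed.

Lemma Zp_redD a b : Zp_red (a + b) = Zp_red a + Zp_red b.
Proof. by rewrite -[a]natr_Zp -[b]natr_Zp -natrD !Zp_red_nat natrD. Qed.

Lemma Zp_redM a b : Zp_red (a * b) = Zp_red a * Zp_red b.
Proof. by rewrite -[a]natr_Zp -[b]natr_Zp -natrM !Zp_red_nat natrM. Qed.

Lemma Zp_red0 : Zp_red 0 = 0. Proof. exact: (Zp_red_nat 0). Qed.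

Lemma Zp_redN a : Zp_red (- a) = - Zp_red a.
Proof. by apply/eqP; rewrite -addr_eq0 -Zp_redD addNr Zp_red0. Qed.

Lemma Zp_redV a : a \is a GRing.unit -> Zp_red a^-1 = (Zp_red a)^-1.
Proof.
move=> ua; have e : Zp_red a * Zp_red a^-1 = 1 by rewrite -Zp_redM mulrV ?Zp_red1.
have u : Zp_red a \is a GRing.unit by apply/unitrP; exists (Zp_red a^-1); rewrite mulrC e.
by apply: (mulrI u); rewrite e mulrV.
Qed.

Lemma Zp_red_eq0 a : (Zp_red a == 0) = (d %| a)%N.
Proof. exact: Zp_nat_eq0. Qed.

End Reduction.

(* The term at n is a residue modulo p^(n+1): the index shift avoids Z/1,
   for which 'Z_1 is not the zero ring. *)
Definition coherent p (a : forall n, 'Z_(p ^ n.+1)) : bool :=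
  `[< forall n, Zp_red (p ^ n.+1) (a n.+1) = a n >].

(* The proof that p is prime is a parameter of the type so that the integral
   domain structure, hence the fraction field, can be inferred from it. *)
Record padic_int p (p_pr : prime p) := PadicInt
  { presidue : forall n, 'Z_(p ^ n.+1); _ : coherent presidue }.

Section PadicInt.
Variables (p : nat) (p_pr : prime p).
Local Notation padic_int := (padic_int p_pr).

HB.instance Definition _ := [isSub for @presidue p p_pr].
HB.instance Definition _ := [Choice of padic_int by <:].
Implicit Types x y z : padic_int.

Lemma padic_intP x y : (forall n, presidue x n = presidue y n) -> x = y.
Proof. by move=> e; apply: val_inj; apply: functional_extensionality_dep. Qed.

Lemma presidueE x n : Zp_red (p ^ n.+1) (presidue x n.+1) = presidue x n.
Proof. by have /asboolP/(_ n) := valP x. Qed.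

Lemma pexp_gt1 n : (1 < p ^ n.+1)%N.
Proof. by rewrite -(exp1n n.+1) ltn_exp2r // prime_gt1. Qed.

Let dvS n : (p ^ n.+1 %| p ^ n.+2)%N. Proof. exact: dvdn_exp2l. Qed.

Definition padic_int_make (a : forall n, 'Z_(p ^ n.+1))
  (h : forall n, Zp_red (p ^ n.+1) (a n.+1) = a n) : padic_int :=
  PadicInt p_pr (introT (asboolP _) h).

Definition pzero := padic_int_make (a := fun=> 0)
  (fun n => Zp_red0 (pexp_gt1 n) (pexp_gt1 n.+1) (dvS n)).
Definition pone := padic_int_make (a := fun=> 1)
  (fun n => Zp_red1 (pexp_gt1 n) (pexp_gt1 n.+1) (dvS n)).

Fact padd_subproof x y n : Zp_red (p ^ n.+1) (presidue x n.+1 + presidue y n.+1)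
  = presidue x n + presidue y n.
Proof. by rewrite Zp_redD ?presidueE ?pexp_gt1. Qed.
Definition padd x y := padic_int_make (padd_subproof x y).

Fact pmul_subproof x y n : Zp_red (p ^ n.+1) (presidue x n.+1 * presidue y n.+1)
  = presidue x n * presidue y n.
Proof. by rewrite Zp_redM ?presidueE ?pexp_gt1. Qed.
Definition pmul x y := padic_int_make (pmul_subproof x y).

Fact popp_subproof x n : Zp_red (p ^ n.+1) (- presidue x n.+1) = - presidue x n.
Proof. by rewrite Zp_redN ?presidueE ?pexp_gt1. Qed.
Definition popp x := padic_int_make (popp_subproof x).

Fact paddA : associative padd.
Proof. by move=> x y z; apply: padic_intP => n; apply: addrA. Qed.
Fact paddC : commutative padd.
Proof. by move=> x y; apply: padic_intP => n; apply: addrC. Qed.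
Fact padd0 : left_id pzero padd.
Proof. by move=> x; apply: padic_intP => n; apply: add0r. Qed.
Fact paddN : left_inverse pzero popp padd.
Proof. by move=> x; apply: padic_intP => n; apply: addNr. Qed.
HB.instance Definition _ := GRing.isZmodule.Build padic_int paddA paddC padd0 paddN.

Fact pmulA : associative pmul.
Proof. by move=> x y z; apply: padic_intP => n; apply: mulrA. Qed.
Fact pmulC : commutative pmul.
Proof. by move=> x y; apply: padic_intP => n; apply: mulrC. Qed.
Fact pmul1 : left_id pone pmul.
Proof. by move=> x; apply: padic_intP => n; apply: mul1r. Qed.
Fact pmulD : left_distributive pmul padd.
Proof. by move=> x y z; apply: padic_intP => n; apply: mulrDl. Qed.
Fact pone_neq0 : pone != 0.
Proof. by apply/eqP => /(congr1 (fun x => presidue x 0))/eqP; rewrite oner_eq0. Qed.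
HB.instance Definition _ :=
  GRing.Zmodule_isComNzRing.Build padic_int pmulA pmulC pmul1 pmulD pone_neq0.

Lemma presidue0 n : presidue (0 : padic_int) n = 0. Proof. by []. Qed.
Lemma presidue1 n : presidue (1 : padic_int) n = 1. Proof. by []. Qed.
Lemma presidueD x y n : presidue (x + y) n = presidue x n + presidue y n.
Proof. by []. Qed.
Lemma presidueN x n : presidue (- x) n = - presidue x n. Proof. by []. Qed.
Lemma presidueM x y n : presidue (x * y) n = presidue x n * presidue y n.
Proof. by []. Qed.
Lemma presidue_nat k n : presidue (k%:R : padic_int) n = k%:R.
Proof. by elim: k => // k IH; rewrite -!natr1 presidueD IH. Qed.

Lemma presidue_red x m n : (n <= m)%N -> Zp_red (p ^ n.+1) (presidue x m) = presidue x n.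
Proof.
elim: m => [|m IH]; first by rewrite leqn0 => /eqP ->; rewrite /Zp_red natr_Zp.
rewrite leq_eqVlt => /predU1P [-> |]; first by rewrite /Zp_red natr_Zp.
rewrite ltnS => nm; rewrite -(IH nm) -(presidueE x m).
rewrite -[in LHS](natr_Zp (presidue x m.+1)) /(@Zp_red _ (p ^ m.+1)).
rewrite !Zp_red_nat ?pexp_gt1 //;
  by rewrite dvdn_exp2l // ltnW.
Qed.

Lemma presidue_eq0 x m n : (n <= m)%N ->
  (presidue x n == 0) = (p ^ n.+1 %| presidue x m)%N.
Proof. by move=> nm; rewrite -(presidue_red x nm) Zp_red_eq0 ?pexp_gt1. Qed.

Lemma presidue_unit x n :
  (presidue x n \is a GRing.unit) = (presidue x 0 != 0).
Proof.
rewrite -(natr_Zp (presidue x n)) unitZpE ?pexp_gt1 // coprime_pexpl //.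
by rewrite prime_coprime // (presidue_eq0 x (leq0n n)) expn1.
Qed.

Definition punit : {pred padic_int} := [pred x | presidue x 0 != 0].

Fact pinv_subproof x n : Zp_red (p ^ n.+1) (presidue x n.+1)^-1 = (presidue x n)^-1.
Proof.
have [u|nu] := boolP (presidue x n.+1 \is a GRing.unit).
  by rewrite Zp_redV ?presidueE ?pexp_gt1.
by rewrite !invr_out ?presidueE // presidue_unit -(presidue_unit x n.+1).
Qed.
Definition pinv x := padic_int_make (pinv_subproof x).

Fact pmulV : {in punit, left_inverse 1 pinv *%R}.
Proof. by move=> x ux; apply: padic_intP => n; apply: mulVr; rewrite presidue_unit. Qed.
Fact punitP x y : y * x = 1 -> punit x.
Proof.
move=> /(congr1 (fun x => presidue x 0)) e; rewrite /punit /= -(presidue_unit x 0).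
by apply/unitrP; exists (presidue y 0); split; last rewrite mulrC; exact: e.
Qed.
Fact pinv_out : {in [predC punit], pinv =1 id}.
Proof.
by move=> x ux; apply: padic_intP => n; apply: invr_out; rewrite presidue_unit.
Qed.
HB.instance Definition _ :=
  GRing.ComNzRing_hasMulInverse.Build padic_int pmulV punitP pinv_out.

Lemma padic_int_neq0 x : x != 0 -> exists n, presidue x n != 0.
Proof.
move=> x0; apply: contrapT => h; case/eqP: x0; apply: padic_intP => n.
by apply/eqP; apply: contrapT => /negP xn; apply: h; exists n.
Qed.

(* The least n such that x is nonzero modulo p^(n+1), that is, the largest n
   such that p^n divides x; 0 by convention at x = 0. *)
Definition pval x : nat :=
  if pselect (exists n, presidue x n != 0) is left ex then ex_minn ex else 0%N.

Variant pval_spec x : nat -> Prop :=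
  | PvalSpec v of presidue x v != 0
      & (forall n, (n < v)%N -> presidue x n = 0) : pval_spec x v.

Lemma pvalP x : x != 0 -> pval_spec x (pval x).
Proof.
move=> /padic_int_neq0 ex; rewrite /pval; case: pselect => // ex'.
case: ex_minnP => v v0 vmin; split => // n nv; apply/eqP; apply: contraTT nv.
by rewrite -leqNgt; apply: vmin.
Qed.

Lemma pval_eq x v : presidue x v != 0 ->
  (forall n, (n < v)%N -> presidue x n = 0) -> pval x = v.
Proof.
move=> xv xlt; have x0 : x != 0 by apply: contraNneq xv => ->.
case: (pvalP x0) => w xw xltw; apply/eqP; rewrite eqn_leq; apply/andP; split.
  by rewrite leqNgt; apply/negP => /xltw; apply/eqP.
by rewrite leqNgt; apply/negP => /xlt; apply/eqP.
Qed.

(* A nonzero x has, modulo any high enough power of p, a representative with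
   p-adic valuation [pval x]. *)
Lemma logn_presidue x m : x != 0 -> (pval x <= m)%N ->
  logn p (presidue x m) = pval x /\ (0 < presidue x m)%N.
Proof.
move=> x0 vm; case: (pvalP x0) vm => v xv xlt vm.
have xm : (0 < presidue x m)%N.
  by rewrite lt0n; apply: contraNneq xv => e; rewrite (presidue_eq0 x vm) e dvdn0.
split=> //; apply/eqP; rewrite eqn_leq; apply/andP; split.
  by rewrite leqNgt -pfactor_dvdn // -presidue_eq0.
case: v vm {xv} xlt => // v vm xlt; rewrite -pfactor_dvdn // -(presidue_eq0 x (ltnW vm)).
by rewrite xlt.
Qed.

Lemma presidueM_eq0 x y m n : (n <= m)%N ->
  (presidue (x * y) n == 0) = (p ^ n.+1 %| presidue x m * presidue y m)%N.
Proof.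
move=> nm; rewrite -(presidue_red (x * y) nm) presidueM Zp_redM ?pexp_gt1 ?dvdn_exp2l //.
by rewrite /Zp_red -natrM Zp_nat_eq0 ?pexp_gt1.
Qed.

Lemma pvalM_subproof x y : x != 0 -> y != 0 ->
  presidue (x * y) (pval x + pval y) != 0 /\
  forall n, (n < pval x + pval y)%N -> presidue (x * y) n = 0.
Proof.
move=> x0 y0; set m := (pval x + pval y)%N.
have [lx px] := logn_presidue x0 (leq_addr (pval y) _ : _ <= m)%N.
have [ly py] := logn_presidue y0 (leq_addl (pval x) _ : _ <= m)%N.
have e n : (n <= m)%N -> (presidue (x * y) n == 0) = (n < m)%N.
  move=> nm; rewrite (presidueM_eq0 x y nm) pfactor_dvdn ?muln_gt0 ?px //.
  by rewrite lognM // lx ly.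
by split=> [|n nm]; [rewrite e // ltnn | apply/eqP; rewrite e // ltnW].
Qed.

Fact padic_int_idomain x y : x * y = 0 -> (x == 0) || (y == 0).
Proof.
move=> xy; apply/negPn; rewrite negb_or; apply/negP => /andP[x0 y0].
by case: (pvalM_subproof x0 y0); rewrite xy eqxx.
Qed.
HB.instance Definition _ :=
  GRing.ComUnitRing_isIntegral.Build padic_int padic_int_idomain.

Lemma pvalM x y : x != 0 -> y != 0 -> pval (x * y) = (pval x + pval y)%N.
Proof. by move=> x0 y0; case: (pvalM_subproof x0 y0) => *; apply: pval_eq. Qed.

Definition pnorm_int x : rat := if x == 0 then 0 else p%:R ^- pval x.

Let p_gt0 : 0 < p%:R :> rat. Proof. by rewrite ltr0n prime_gt0. Qed.

Lemma pnorm_int_ge0 x : 0 <= pnorm_int x.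
Proof. by rewrite /pnorm_int; case: ifP => // _; rewrite invr_ge0 exprn_ge0 // ltW. Qed.

Lemma pnorm_int_eq0 x : (pnorm_int x == 0) = (x == 0).
Proof.
by rewrite /pnorm_int; case: ifP; rewrite ?eqxx // invr_eq0 expf_eq0 (gt_eqF p_gt0) andbF.
Qed.

Lemma pnorm_intM x y : pnorm_int (x * y) = pnorm_int x * pnorm_int y.
Proof.
rewrite /pnorm_int mulf_eq0; have [->|x0] := eqVneq x 0; first by rewrite /= mul0r.
have [->|y0] := eqVneq y 0; first by rewrite /= mulr0.
by rewrite /= pvalM // exprD invfM.
Qed.

Lemma pvalN x : pval (- x) = pval x.
Proof.
have [->|x0] := eqVneq x 0; first by rewrite oppr0.
case: (pvalP x0) => v xv xlt; apply: pval_eq; first by rewrite presidueN oppr_eq0.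
by move=> n /xlt e; rewrite presidueN e oppr0.
Qed.

Lemma pnorm_intN x : pnorm_int (- x) = pnorm_int x.
Proof. by rewrite /pnorm_int oppr_eq0 pvalN. Qed.

Lemma pnorm_int_leX x k :
  (pnorm_int x <= p%:R ^- k) = (x == 0) || (k <= pval x)%N.
Proof.
rewrite /pnorm_int; case: ifP => _ /=; first by rewrite invr_ge0 exprn_ge0 // ltW.
rewrite lef_pV2 ?posrE ?exprn_gt0 //.
by rewrite ler_eXn2l ?ltr1n ?prime_gt1.
Qed.

Lemma pval_ge x k : x != 0 -> (forall n, (n < k)%N -> presidue x n = 0) ->
  (k <= pval x)%N.
Proof.
move=> x0 h; case: (pvalP x0) => v xv _; rewrite leqNgt; apply/negP => /h.
exact/eqP.
Qed.

Lemma pnorm_intD x y :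
  pnorm_int (x + y) <= Num.max (pnorm_int x) (pnorm_int y).
Proof.
have [->|x0] := eqVneq x 0; first by rewrite add0r le_max lexx orbT.
have [->|y0] := eqVneq y 0; first by rewrite addr0 le_max lexx.
wlog xy : x y x0 y0 / (pval x <= pval y)%N.
  move=> h; have [/h|/ltnW/h] := leqP (pval x) (pval y); first exact.
  by rewrite addrC maxC; apply.
rewrite le_max; apply/orP; left; rewrite {2}/pnorm_int (negPf x0) pnorm_int_leX.
have [//|xy0 /=] := eqVneq (x + y) 0; apply: pval_ge => // n nx.
rewrite presidueD; case: (pvalP x0) nx xy => v _ h nx vy; rewrite (h n nx).
by case: (pvalP y0) vy => w _ hw vw; rewrite (hw n (leq_trans nx vw)) addr0.
Qed.

Lemma pnorm_int1 : pnorm_int 1 = 1.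
Proof.
rewrite /pnorm_int oner_eq0 (_ : pval 1 = 0%N) ?invr1 //.
by apply: pval_eq; rewrite // presidue1 oner_eq0.
Qed.

Lemma pnorm_int_p : pnorm_int p%:R = p%:R^-1.
Proof.
rewrite /pnorm_int; have h1 : presidue (p%:R : padic_int) 1 != 0.
  rewrite presidue_nat Zp_nat_eq0 ?pexp_gt1 // gtnNdvd ?prime_gt0 //.
  by rewrite -[X in (X < _)%N]expn1 ltn_exp2l // prime_gt1.
have -> : pval (p%:R : padic_int) = 1%N.
  apply: pval_eq h1 _ => -[|//] _; apply/eqP.
  by rewrite presidue_nat Zp_nat_eq0 ?pexp_gt1 // expn1.
have /negPf-> : p%:R != 0 :> padic_int by apply: contraNneq h1 => ->.
by rewrite expr1.
Qed.

Lemma pnorm_int_pX k : pnorm_int (p%:R ^+ k) = p%:R ^- k.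
Proof.
elim: k => [|k IH]; first by rewrite !expr0 invr1 pnorm_int1.
by rewrite !exprS pnorm_intM IH pnorm_int_p invfM.
Qed.

Lemma pnorm_int_unit x : pnorm_int x = 1 -> x \is a GRing.unit.
Proof.
move=> x1; rewrite -[_ \is a _]/(presidue x 0 != 0); apply/negP => /eqP h.
have x0 : x != 0 by rewrite -pnorm_int_eq0 x1 oner_eq0.
have : pnorm_int x <= p%:R ^- 1.
  by rewrite pnorm_int_leX (negPf x0) /=; apply: pval_ge => // -[|//].
by rewrite x1 expr1 leNgt invf_lt1 // ltr1n prime_gt1.
Qed.

Lemma pnorm_int_le1 x : pnorm_int x <= 1.
Proof. by have := pnorm_int_leX x 0; rewrite leq0n orbT invr1. Qed.

Fact pdiv_subproof k x n :
  Zp_red (p ^ n.+1) ((presidue x (n.+1 + k) %/ p ^ k)%:R : 'Z_(p ^ n.+2))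
  = (presidue x (n + k) %/ p ^ k)%:R.
Proof.
rewrite Zp_red_nat ?pexp_gt1 //.
rewrite -(presidue_red x (leq_addl 1 (n + k))) add1n /Zp_red val_Zp_nat ?pexp_gt1 //.
rewrite {1}(divn_eq (presidue x (n + k).+1) (p ^ (n + k).+1)) -addSn expnD mulnA.
rewrite divnMDl ?expn_gt0 ?prime_gt0 // natrD natrM.
rewrite [X in _ * X + _](_ : _ = 0) ?mulr0 ?add0r //.
by apply/eqP; rewrite Zp_nat_eq0 ?pexp_gt1.
Qed.

Lemma pnorm_int_dvd x k :
  pnorm_int x <= p%:R ^- k <-> exists y, x = p%:R ^+ k * y.
Proof.
split=> [|[y ->]]; last first.
  by rewrite pnorm_intM pnorm_int_pX ler_piMr ?pnorm_int_le1 // invr_ge0 exprn_ge0 // ltW.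
rewrite pnorm_int_leX => kx; exists (padic_int_make (pdiv_subproof k x)).
apply: padic_intP => n; rewrite -natrX presidueM presidue_nat /=.
rewrite -natrM muln_divA ?mulKn ?expn_gt0 ?prime_gt0 //.
  by rewrite -(presidue_red x (leq_addr k n)).
case/predU1P: kx => [->|]; first by rewrite presidue0 dvdn0.
case: k => [|k kx]; first by rewrite dvd1n.
rewrite -presidue_eq0 ?addnS ?leqW ?leq_addl //.
have [->//|x0] := eqVneq x 0.
by case: (pvalP x0) kx => v _ h /h ->.
Qed.

End PadicInt.

Definition padic p (p_pr : prime p) := {fraction padic_int p_pr}.
HB.instance Definition _ p (p_pr : prime p) := GRing.Field.on (padic p_pr).

Definition padic_of_int p (p_pr : prime p) (x : padic_int p_pr) : padic p_pr :=
  FracField.tofrac x.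
HB.instance Definition _ p (p_pr : prime p) :=
  GRing.RMorphism.copy (@padic_of_int p p_pr) (@FracField.tofrac (padic_int p_pr)).

Notation "x %:Qp" := (padic_of_int x)
  (at level 2, left associativity, format "x %:Qp") : ring_scope.

Section Padic.
Variables (p : nat) (p_pr : prime p).
Local Notation Z := (padic_int p_pr).
Local Notation Q := (padic p_pr).
Implicit Types (x y z : Q) (a b : Z).

Lemma padic_of_int_eq0 a : (a%:Qp == 0) = (a == 0).
Proof. exact: tofrac_eq0. Qed.

Lemma padic_numden x : x = (\n_(repr x))%:Qp / (\d_(repr x))%:Qp.
Proof.
have d0 : (\d_(repr x))%:Qp != 0 by rewrite padic_of_int_eq0 denom_ratioP.
apply: (mulIf d0); rewrite divfK //.
rewrite -{1}(reprK x) /padic_of_int; unlock FracField.tofrac.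
rewrite -[LHS]FracField.pi_mul; apply/eqmodP; rewrite /= FracField.equivfE.
rewrite /FracField.mulf !numden_Ratio ?mulr1 ?oner_neq0 ?denom_ratioP //.
by rewrite mulrC.
Qed.

(* |a / b| = |a| / |b|, computed on a chosen representative of the fraction; it
   does not depend on this choice by [pnorm_frac] below. *)
Definition pnorm x : rat := pnorm_int \n_(repr x) / pnorm_int \d_(repr x).

Lemma pnorm_frac a b : b != 0 -> pnorm (a%:Qp / b%:Qp) = pnorm_int a / pnorm_int b.
Proof.
move=> b0; rewrite /pnorm; set x := a%:Qp / b%:Qp.
have d0 : \d_(repr x) != 0 := denom_ratioP _.
have := padic_numden x; move: (\n_(repr x)) (\d_(repr x)) d0 => n d d0.
move/eqP; rewrite /x eqr_div ?padic_of_int_eq0 // -!rmorphM /= tofrac_eq => /eqP e.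
apply/eqP; rewrite eqr_div ?pnorm_int_eq0 // -!pnorm_intM -e //.
Qed.

Lemma padicP x : exists ab, ab.2 != 0 /\ x = ab.1%:Qp / ab.2%:Qp.
Proof.
by exists (frac (repr x)); split; [exact: denom_ratioP | exact: padic_numden].
Qed.

Lemma pnorm_of_int a : pnorm a%:Qp = pnorm_int a.
Proof. by have := pnorm_frac a (oner_neq0 _); rewrite rmorph1 !divr1 pnorm_int1 divr1. Qed.

Lemma pnorm_ge0 x : 0 <= pnorm x.
Proof. by rewrite divr_ge0 ?pnorm_int_ge0. Qed.

Lemma pnorm0 : pnorm 0 = 0.
Proof. by rewrite -(rmorph0 (@padic_of_int p p_pr)) pnorm_of_int /pnorm_int eqxx. Qed.

Lemma pnorm_eq0 x : (pnorm x == 0) = (x == 0).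
Proof.
have [[a b] /= [b0 ->]] := padicP x.
rewrite pnorm_frac // !mulf_eq0 !invr_eq0 !pnorm_int_eq0 !padic_of_int_eq0.
by rewrite (negPf b0).
Qed.

Lemma pnormM x y : pnorm (x * y) = pnorm x * pnorm y.
Proof.
have [[a b] /= [b0 ->]] := padicP x; have [[c d] /= [d0 ->]] := padicP y.
by rewrite mulf_div -!rmorphM !pnorm_frac ?mulf_neq0 // !pnorm_intM mulf_div.
Qed.

Lemma pnormN x : pnorm (- x) = pnorm x.
Proof.
have [[a b] /= [b0 ->]] := padicP x.
by rewrite -mulNr -rmorphN !pnorm_frac // pnorm_intN.
Qed.

Lemma pnormD x y : pnorm (x + y) <= Num.max (pnorm x) (pnorm y).
Proof.
have [[a b] /= [b0 ->]] := padicP x; have [[c d] /= [d0 ->]] := padicP y.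
rewrite addf_div ?padic_of_int_eq0 // -!rmorphM -rmorphD !pnorm_frac ?mulf_neq0 //.
have bd0 : 0 < pnorm_int (b * d) by rewrite lt_def pnorm_int_ge0 pnorm_int_eq0 mulf_neq0.
rewrite ler_pdivrMr //; apply: le_trans (pnorm_intD _ _) _.
have bn : pnorm_int b != 0 by rewrite pnorm_int_eq0.
have dn : pnorm_int d != 0 by rewrite pnorm_int_eq0.
rewrite maxr_pMl ?(ltW bd0) // !pnorm_intM.
by rewrite mulrA divfK // [pnorm_int b * _]mulrC [_ / _ * _]mulrA divfK.
Qed.

Lemma pnorm_p : pnorm p%:R = p%:R^-1.
Proof. by rewrite -(rmorph_nat (@padic_of_int p p_pr)) pnorm_of_int pnorm_int_p. Qed.

(* Z_p is the closed unit ball of Q_p. *)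
Lemma pnorm_le1 x : pnorm x <= 1 <-> exists a, x = a%:Qp.
Proof.
split=> [|[a ->]]; last by rewrite pnorm_of_int pnorm_int_le1.
have [[a b] /= [b0 ->]] := padicP x; rewrite pnorm_frac //.
have b_gt0 : 0 < pnorm_int b by rewrite lt_def pnorm_int_ge0 pnorm_int_eq0 b0.
rewrite ler_pdivrMr // mul1r => ab.
have eb : pnorm_int b = p%:R ^- pval b by rewrite /pnorm_int (negPf b0).
have /pnorm_int_dvd [u bE] : pnorm_int b <= p%:R ^- pval b by rewrite eb.
have /pnorm_int_dvd [c ->] : pnorm_int a <= p%:R ^- pval b by rewrite -eb.
have pk0 : (p%:R ^+ pval b)%:Qp != 0 :> Q.
  by rewrite padic_of_int_eq0 -pnorm_int_eq0 pnorm_int_pX -eb gt_eqF.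
have uU : u \is a GRing.unit.
  have bn : pnorm_int b != 0 by rewrite gt_eqF.
  apply: pnorm_int_unit; apply: (mulfI bn).
  by rewrite mulr1 {1}eb -pnorm_int_pX -pnorm_intM -bE.
move: bE pk0; set k := pval b => bE pk0.
exists (c / u); rewrite bE !rmorphM /= rmorphV // invfM mulrACA.
by rewrite divff ?mul1r.
Qed.

(* The p-adic absolute value takes rational values, which makes Q_p a metric
   space over rat; limits and convergence in Q_p refer to this metric. *)
Definition pdist x y := pnorm (x - y).

Fact pdistxx x : pdist x x = 0. Proof. by rewrite /pdist subrr pnorm0. Qed.
Fact pdist_positivity x y : pdist x y = 0 -> x = y.
Proof. by move/eqP; rewrite pnorm_eq0 subr_eq0 => /eqP. Qed.
Fact pdist_sym x y : pdist x y = pdist y x.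
Proof. by rewrite /pdist -pnormN opprB. Qed.
Fact pdist_triangle y x z : pdist x z <= pdist x y + pdist y z.
Proof.
rewrite /pdist (_ : x - z = (x - y) + (y - z)); last by rewrite addrA subrK.
apply: le_trans (pnormD _ _) _; rewrite ge_max.
by rewrite lerDl lerDr !pnorm_ge0.
Qed.

HB.instance Definition _ :=
  isMetric.Build rat Q pdistxx pdist_positivity pdist_sym pdist_triangle.
HB.instance Definition _ := isPointed.Build Q 0.

End Padic.

(* A power series in Q_p[[z]] is given by its sequence of coefficients. *)
Section PowerSeries.
Variables (p : nat) (p_pr : prime p).

Definition padic_series (f : nat -> padic p_pr) (z : padic p_pr) : nat -> padic p_pr :=
  [series f k * z ^+ k]_k.

(* Meaningful when [padic_series f z] converges. *)
Definition padic_series_eval f z : padic p_pr := limn (padic_series f z).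

End PowerSeries.

(* Convergence along this filter is unconditional convergence of the net of
   finite partial sums. *)
Definition totally (I : choiceType) : set_system {fset I} :=
  filter_from setT (fun A => [set B | (A `<=` B)%fset]).

#[export] Instance totally_filter (I : choiceType) : ProperFilter (@totally I).
Proof.
apply: filter_from_proper; last by move=> A _; exists A; apply: fsubset_refl.
apply: filter_fromT_filter; first by exists fset0.
move=> A B; exists (A `|` B)%fset => C /= ABC; split.
  by apply: fsubset_trans ABC; apply: fsubsetUl.
by apply: fsubset_trans ABC; apply: fsubsetUr.
Qed.

Definition multindex n := {ffun 'I_n -> nat}.

Definition mdeg n (k : multindex n) : nat := \sum_(j < n) k j.

Section MultivariatePowerSeries.
Variables (p : nat) (p_pr : prime p) (n : nat).

(* An element of Z_p[[x_1, ..., x_n]], given by its coefficients. *)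
Definition mpseries := multindex n -> padic_int p_pr.

Definition mpvar (i : 'I_n) : mpseries :=
  fun k => (k == [ffun j => nat_of_bool (j == i)])%:R.

Definition mpartial_sum (phi : mpseries) (x : 'I_n -> padic p_pr)
    (A : {fset multindex n}) : padic p_pr :=
  \sum_(k <- A) (phi k)%:Qp * \prod_(j < n) x j ^+ k j.

Definition mpcvg (phi : mpseries) (x : 'I_n -> padic p_pr) : Prop :=
  cvg (mpartial_sum phi x @ @totally (multindex n)).

(* Meaningful when [mpcvg phi x] holds. *)
Definition mpeval (phi : mpseries) (x : 'I_n -> padic p_pr) : padic p_pr :=
  lim (mpartial_sum phi x @ @totally (multindex n)).

End MultivariatePowerSeries.

(* [in_pZ m a] means that a belongs to p^m Z_p. *)
Definition in_pZ p (p_pr : prime p) (m : nat) (a : padic_int p_pr) : Prop :=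
  exists b, a = p%:R ^+ m * b.

(* Main.v *)
Require Import Defs.
From HB Require Import structures.
From mathcomp Require Import all_boot all_order all_algebra finmap.
From mathcomp Require Import fraction.
From mathcomp Require Import all_classical.
From mathcomp Require Import topology sequences.
From mathcomp Require Import zify.

(* Let x_j be the j-th iterate at omega of the map F defined by the phi_i. Modulo
   p^m, F agrees with a polynomial map P = x + p G, and composition with P changes
   a polynomial function by p times a polynomial function; hence the m-th finite
   difference a_m of (x_j) at 0 lies in p^m Z_p. As 2 v_p(m!) <= m, the coefficients
   of the Mahler series sum_m a_m binom(z, m) = sum_m (a_m / m!) z(z - 1)...(z - m + 1)
   lie in p^(m/2) Z_p, so it can be rearranged into a power series converging on Z_p.
   Its sum f interpolates (x_j); f and F are 1-Lipschitz, so f(z + 1) = F(f(z)),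
   which holds on the dense subset N, holds on Z_p. *)

Set Implicit Arguments.
Unset Strict Implicit.
Unset Printing Implicit Defensive.

Import Order.TTheory GRing.Theory Num.Theory.

Local Open Scope classical_set_scope.
Local Open Scope ring_scope.

(** * Divisibility by powers of p in Z_p *)

Section PowersOfP.
Variables (p : nat) (p_pr : prime p).
Local Notation Z := (padic_int p_pr).
Implicit Types (a b c : Z) (m n : nat).

Lemma in_pZ_0 m : in_pZ m (0 : Z).
Proof. by exists 0; rewrite mulr0. Qed.

Lemma in_pZ0 a : in_pZ 0 a.
Proof. by exists a; rewrite expr0 mul1r. Qed.

Lemma in_pZD m a b : in_pZ m a -> in_pZ m b -> in_pZ m (a + b).
Proof. by move=> [c ->] [d ->]; exists (c + d); rewrite mulrDr. Qed.

Lemma in_pZN m a : in_pZ m a -> in_pZ m (- a).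
Proof. by move=> [c ->]; exists (- c); rewrite mulrN. Qed.

Lemma in_pZMl m a b : in_pZ m b -> in_pZ m (a * b).
Proof. by move=> [c ->]; exists (a * c); rewrite mulrCA. Qed.

Lemma in_pZMr m a b : in_pZ m a -> in_pZ m (a * b).
Proof. by rewrite mulrC; apply: in_pZMl. Qed.

Lemma in_pZC m a b : in_pZ m (a - b) -> in_pZ m (b - a).
Proof. by move=> /in_pZN; rewrite opprB. Qed.

Lemma in_pZ_trans m b a c : in_pZ m (a - b) -> in_pZ m (b - c) -> in_pZ m (a - c).
Proof. by move=> ab bc; rewrite -[a](subrK b) -addrA; apply: in_pZD. Qed.

Lemma in_pZ_leq m n a : (m <= n)%N -> in_pZ n a -> in_pZ m a.
Proof. by move=> mn [c ->]; exists (p%:R ^+ (n - m) * c); rewrite mulrA -exprD subnKC. Qed.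

Lemma in_pZ_sum m (I : Type) (r : seq I) (P : pred I) (F : I -> Z) :
  (forall i, P i -> in_pZ m (F i)) -> in_pZ m (\sum_(i <- r | P i) F i).
Proof. by move=> h; apply: big_ind => //; [apply: in_pZ_0 | apply: in_pZD]. Qed.

(** The index shift reflects that [presidue a m] is the residue modulo p^(m+1). *)
Lemma in_pZS m a : in_pZ m.+1 a <-> presidue a m = 0.
Proof.
split=> [[c ->]|a0].
  rewrite -natrX presidueM presidue_nat (_ : _%:R = 0) ?mul0r //.
  by apply/eqP; rewrite Zp_nat_eq0 ?pexp_gt1.
apply/pnorm_int_dvd; rewrite pnorm_int_leX.
have [//|nz /=] := eqVneq a 0; apply: pval_ge => // n; rewrite ltnS => nm.
by rewrite -(presidue_red a nm) a0 Zp_red0 ?pexp_gt1 ?dvdn_exp2l.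
Qed.

Lemma in_pZ_eq0 a : (forall m, in_pZ m a) -> a = 0.
Proof. by move=> h; apply: padic_intP => n; apply/in_pZS/h. Qed.

Lemma padic_int_lim (u : nat -> Z) : (forall m, in_pZ m (u m.+1 - u m)) ->
  exists l, forall m, in_pZ m (l - u m).
Proof.
move=> cu.
(* From index n+1 on, the terms of [u] agree modulo p^(n+1), so the residue of [u n.+1] is already
   that of the limit. *)
have h n : Zp_red (p ^ n.+1) (presidue (u n.+2) n.+1) = presidue (u n.+1) n.
  rewrite presidueE; apply/eqP; rewrite -subr_eq0 -presidueN -presidueD.
  by apply/eqP/in_pZS/cu.
exists (padic_int_make p_pr h) => -[|m]; first exact: in_pZ0.
by apply/in_pZS; rewrite presidueD presidueN /= subrr.
Qed.

Lemma padic_int_nat_approx m a : exists j : nat, in_pZ m (a - j%:R).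
Proof.
case: m => [|m]; first by exists 0%N; apply: in_pZ0.
exists (presidue a m); apply/in_pZS.
by rewrite presidueD presidueN presidue_nat natr_Zp subrr.
Qed.

Lemma pnorm_le_pZ m a : pnorm a%:Qp <= p%:R ^- m <-> in_pZ m a.
Proof. by rewrite pnorm_of_int; apply: pnorm_int_dvd. Qed.

Lemma in_pZ_horner m (q : {poly Z}) a :
  (forall k, in_pZ m q`_k) -> in_pZ m q.[a].
Proof. by move=> h; rewrite horner_coef; apply: in_pZ_sum => i _; apply: in_pZMr. Qed.

Lemma horner_pZ_lipschitz m (q : {poly Z}) a b :
  in_pZ m (a - b) -> in_pZ m (q.[a] - q.[b]).
Proof.
move=> ab; rewrite !horner_coef -sumrB; apply: in_pZ_sum => i _.
by rewrite -mulrBr subrXX; apply/in_pZMl/in_pZMr.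
Qed.

Lemma padic_int_nat_unit (k : nat) : coprime p k -> (k%:R : Z) \is a GRing.unit.
Proof.
move=> pk; rewrite -[_ \is a _]/(presidue k%:R 0 != 0).
by rewrite presidue_nat Zp_nat_eq0 ?pexp_gt1 // expn1 -prime_coprime.
Qed.

(** Legendre's formula. The sum is truncated at K and the bound strengthened by the term floor(m /
    p^K), which lets the induction telescope through p floor(m / p^(K+1)) <= floor(m / p^K). *)
Lemma logn_fact_le m : (p.-1 * logn p m`! <= m)%N.
Proof.
have h K : (p.-1 * (\sum_(1 <= k < K.+1) m %/ p ^ k) + m %/ p ^ K <= m)%N.
  elim: K => [|K IH]; first by rewrite big_geq // muln0 divn1.
  rewrite big_nat_recr //=; apply: leq_trans IH.
  rewrite mulnDr -addnA leq_add2l -mulSnr prednK ?prime_gt0 //.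
  by rewrite expnSr divnMA mulnC leq_divM.
by rewrite logn_fact //; apply: leq_trans (h m); apply: leq_addr.
Qed.

(** As p - 1 >= 2, the valuation v of m! satisfies 2v <= m. Dividing by m! thus costs at most half
    of the m factors p; the cofactor of p^v in m! is a unit. *)
Lemma div_fact_pZ m a : (2 < p)%N -> in_pZ m a ->
  exists2 c, in_pZ m./2 c & c * m`!%:R = a.
Proof.
move=> p_gt2 [b ->].
have [u pu mu] := pfactor_coprime p_pr (fact_gt0 m).
have uU := padic_int_nat_unit pu; set v := logn p m`! in mu.
have vm : (v + m./2 <= m)%N.
  have v2 : (v.*2 <= m)%N.
    rewrite -muln2 mulnC; apply: leq_trans (logn_fact_le m).
    by rewrite leq_mul2r; apply/orP; right; rewrite -ltnS prednK ?prime_gt0.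
  by rewrite -[leqRHS]odd_double_half; lia.
exists (p%:R ^+ (m - v) * b / u%:R).
  rewrite -mulrA; apply: (@in_pZ_leq _ (m - v)); last by exists (b / u%:R).
  by rewrite leq_subRL ?(leq_trans (leq_addr _ _) vm).
have vm' : (v <= m)%N := leq_trans (leq_addr _ _) vm.
by rewrite mu natrM natrX mulrA divrK // mulrAC -exprD subnK.
Qed.

End PowersOfP.

(** * Finite differences and falling factorials *)

Definition fdiff (V : zmodType) (u : nat -> V) : nat -> V := fun j => u j.+1 - u j.

(** Induction on j by Pascal's rule, applied to [u] and to its difference. Any K > j is allowed
    because binomials with m > j vanish. *)
Lemma newton_forward (R : pzRingType) (u : nat -> R) (j K : nat) : (j < K)%N ->
  u j = \sum_(m < K) iter m (@fdiff R) u 0 *+ 'C(j, m).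
Proof.
elim: j u K => [|j IH] u [|K] //; rewrite ltnS => jK.
  by rewrite big_ord_recl bin0 big1 ?addr0.
have -> : u j.+1 = u j + @fdiff R u j by rewrite /fdiff addrC subrK.
rewrite (IH u K.+1) ?(IH (@fdiff R u) K) ?ltnS ?(ltnW jK) //.
rewrite big_ord_recl [RHS]big_ord_recl !bin0 -addrA -big_split /=; congr (_ + _).
by apply: eq_bigr => i _; rewrite -iterSr /= /bump /= add1n binS mulrnDr.
Qed.

Definition ffact_poly (R : nzRingType) (m : nat) : {poly R} := \prod_(i < m) ('X - i%:R%:P).

Lemma size_ffact_poly (R : nzRingType) m : size (ffact_poly R m) = m.+1.
Proof. by rewrite size_prod_XsubC /index_enum -enumT size_enum_ord. Qed.

Lemma horner_ffact_poly (R : comNzRingType) j m : (ffact_poly R m).[j%:R] = (j ^_ m)%:R.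
Proof.
elim: m => [|m IH]; rewrite /ffact_poly; first by rewrite big_ord0 hornerC.
rewrite big_ord_recr /= hornerM IH hornerXsubC ffactnSr natrM.
have [mj|jm] := leqP m j; first by rewrite natrB.
by rewrite ffact_small // !mul0r.
Qed.

(** * Rearranging a Mahler series into a power series *)

Section MahlerSeries.
Variables (p : nat) (p_pr : prime p).
Local Notation Z := (padic_int p_pr).

(** [E] is the sum of the power series [f] on Z_p. Convergence and continuity are stated as
    congruences, so that the construction stays inside Z_p. *)
Lemma mahler_analytic (u : nat -> Z) : (2 < p)%N ->
    (forall m, in_pZ m (iter m (@fdiff Z) u 0)) ->
  exists (f : nat -> Z) (E : Z -> Z),
    [/\ forall z m, exists K0, forall K, (K0 <= K)%N ->
          in_pZ m (E z - \sum_(k < K) f k * z ^+ k),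
        forall m z w, in_pZ m (z - w) -> in_pZ m (E z - E w)
      & forall j, E j%:R = u j].
Proof.
move=> p_gt2 ua.
have /choice[c cP] m : exists c, in_pZ m./2 c /\ c * m`!%:R = iter m (@fdiff Z) u 0.
  by have [c] := div_fact_pZ p_gt2 (ua m); exists c.
(* Terms are added in pairs: those of index 2N and 2N+1 both have coefficients in p^N Z_p, so [U N]
   settles modulo p^N. *)
pose U N := \sum_(m < N.*2) c m *: ffact_poly Z m.
have dU N k : in_pZ N ((U N.+1)`_k - (U N)`_k).
  rewrite /U doubleS !big_ord_recr /= -addrA coefD addrAC subrr add0r coefD !coefZ.
  have [[h0 _] [h1 _]] := (cP N.*2, cP N.*2.+1).
  by apply: in_pZD; apply: in_pZMr; rewrite ?doubleK // in h0 h1 *; rewrite /= uphalf_double in h1.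
have sU N : (size (U N) <= N.*2)%N.
  apply: (leq_trans (size_sum _ _ _)); apply/bigmax_leqP => i _.
  by apply: (leq_trans (size_scale_leq _ _)); rewrite size_ffact_poly.
have /choice[f fP] k := padic_int_lim (dU ^~ k).
have dUz z N : in_pZ N ((U N.+1).[z] - (U N).[z]).
  by rewrite -hornerN -hornerD; apply: in_pZ_horner => k; rewrite coefB.
have /choice[E EP] z := padic_int_lim (dUz z).
exists f, E; split=> [z m|m z w zw|j].
(* [U m] has degree below 2m, so for K >= 2m it can be compared with the truncation of [f]
   coefficient by coefficient. *)
- exists m.*2 => K mK; apply: in_pZ_trans (EP z m) _.
  rewrite (horner_coef_wide _ (leq_trans (sU m) mK)) -sumrB.
  apply: in_pZ_sum => k _; rewrite -mulrBl.
  exact/in_pZMr/in_pZC/fP.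
- apply: in_pZ_trans (EP z m) _; apply: in_pZ_trans (in_pZC (EP w m)).
  exact: horner_pZ_lipschitz.
- apply/eqP; rewrite -subr_eq0; apply/eqP/in_pZ_eq0 => m.
  (* The index N = m + j + 1 serves twice: N >= m gives precision p^m, and 2N > j makes Newton's
     formula exact, so that [U N] takes the value [u j] at j. *)
  have mN : (m <= m + j.+1)%N by apply: leq_addr.
  have := in_pZ_leq mN (EP j%:R (m + j.+1)%N); congr in_pZ; congr (_ - _).
  rewrite (@newton_forward _ u j (m + j.+1).*2); last by lia.
  rewrite /U horner_sum; apply: eq_bigr => i _.
  rewrite hornerZ horner_ffact_poly -bin_ffact natrM mulrCA mulrA.
  by rewrite -[RHS]mulr_natl -mulrA; congr (_ * _); apply: (cP i).2.
Qed.

End MahlerSeries.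

(** * Convergence in Q_p expressed by powers of p *)

Section Topology.
Variables (p : nat) (p_pr : prime p).
Local Notation Q := (padic p_pr).

Lemma pexpN_lt (e : rat) : 0 < e -> exists m, p%:R ^- m < e.
Proof.
move=> e0; exists (Num.bound e^-1).
rewrite -[ltRHS]invrK ltf_pV2 ?posrE ?exprn_gt0 ?invr_gt0 ?ltr0n ?prime_gt0 //.
apply: lt_trans (archi_boundP _) _; first by rewrite invr_ge0 ltW.
by rewrite -natrX ltr_nat ltn_expl // prime_gt1.
Qed.

Lemma padic_cvgP (T : Type) (F : set_system T) {FF : Filter F} (h : T -> Q) (l : Q) :
  h @ F --> l <-> forall m, \forall t \near F, pnorm (l - h t) <= p%:R ^- m.
Proof.
split=> [/cvg_ballP hl m|hl].
  have e0 : 0 < p%:R ^- m :> rat by rewrite invr_gt0 exprn_gt0 // ltr0n prime_gt0.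
  by apply: filterS (hl _ e0) => t; rewrite ballEmdist /= => /ltW.
apply/cvg_ballP => e e0; have [m me] := pexpN_lt e0.
by apply: filterS (hl m) => t ht; rewrite ballEmdist /=; apply: le_lt_trans ht me.
Qed.

Lemma padic_series_cvg (f : nat -> padic_int p_pr) (z l : padic_int p_pr) :
    (forall m, exists K0, forall K, (K0 <= K)%N -> in_pZ m (l - \sum_(k < K) f k * z ^+ k)) ->
  padic_series (fun k => (f k)%:Qp) z%:Qp @ \oo --> l%:Qp.
Proof.
move=> h; apply/padic_cvgP => m; have [K0 hK] := h m.
exists K0 => // K /= /hK /pnorm_le_pZ; congr (is_true (pnorm _ <= _)).
rewrite rmorphB; congr (_ - _); rewrite rmorph_sum /padic_series /series /= big_mkord.
by apply: eq_bigr => i _; rewrite rmorphM rmorphXn.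
Qed.

End Topology.

(** * Values of multivariate power series at integral points *)

Section MultivariateEvaluation.
Variables (p : nat) (p_pr : prime p) (n : nat).
Local Notation Z := (padic_int p_pr).
Local Notation Q := (padic p_pr).
Implicit Types (phi : mpseries p_pr n) (x : 'I_n -> Z) (A B : {fset multindex n}).

Definition mpsum_int phi A x : Z := \sum_(k <- A) phi k * \prod_(j < n) x j ^+ k j.

Lemma mpartial_sum_int phi A x :
  mpartial_sum phi (fun j => (x j)%:Qp) A = (mpsum_int phi A x)%:Qp.
Proof.
rewrite rmorph_sum; apply: eq_bigr => k _; rewrite rmorphM rmorph_prod; congr (_ * _).
by apply: eq_bigr => j _; rewrite rmorphXn.
Qed.

Lemma mpcvg_near phi x m : mpcvg phi (fun j => (x j)%:Qp) ->
  exists A, forall B, (A `<=` B)%fset ->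
    pnorm (mpeval phi (fun j => (x j)%:Qp) - (mpsum_int phi B x)%:Qp) <= p%:R ^- m.
Proof.
move=> /padic_cvgP /(_ m) [A _ hA]; exists A => B AB.
by rewrite -mpartial_sum_int; apply: hA.
Qed.

(* Convergence at (1, ..., 1) already makes the coefficients tend to 0, hence the
   uniformity in [x]. *)
Lemma mpeval_approx phi m : (forall x, mpcvg phi (fun j => (x j)%:Qp)) ->
  exists A, forall B x, (A `<=` B)%fset ->
    pnorm (mpeval phi (fun j => (x j)%:Qp) - (mpsum_int phi B x)%:Qp) <= p%:R ^- m.
Proof.
move=> cphi; have [A hA] := mpcvg_near m (cphi (fun=> 1)).
have small k : k \notin A -> in_pZ m (phi k).
  move=> kA; apply/pnorm_le_pZ.
  (* At (1, ..., 1) a coefficient is the difference of two partial sums, both within p^-m of the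
     limit. *)
  have -> : (phi k)%:Qp = (mpsum_int phi (k |` A)%fset (fun=> 1))%:Qp
                       - (mpsum_int phi A (fun=> 1))%:Qp.
    rewrite /mpsum_int big_fsetU1 //= rmorphD addrK big1 ?mulr1 // => j _.
    by rewrite expr1n.
  set l := mpeval phi (fun=> 1%:Qp) in hA.
  have -> (a b : Q) : a - b = (l - b) - (l - a) by rewrite opprB [RHS]addrC addrA subrK.
  apply: le_trans (pnormD _ _) _; rewrite pnormN ge_max !hA //.
  exact: fsubsetUr.
exists A => B x AB; have [A' hA'] := mpcvg_near m (cphi x).
(* [A'] depends on [x], but passing from [C] back to [B] drops only indices outside [A], whose
   coefficients lie in p^m Z_p. *)
set l := mpeval _ _ in hA' *; pose C := (B `|` A')%fset.
rewrite -[l](subrK (mpsum_int phi C x)%:Qp) -addrA.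
apply: le_trans (pnormD _ _) _; rewrite ge_max hA' ?fsubsetUr //=.
rewrite -rmorphB; apply/pnorm_le_pZ; rewrite /mpsum_int [X in X - _](bigID (mem B)) /=.
have -> : \sum_(k <- C | k \in B) phi k * \prod_(j < n) x j ^+ k j =
          \sum_(k <- B) phi k * \prod_(j < n) x j ^+ k j.
  rewrite -big_filter; apply/perm_big/uniq_perm; rewrite ?filter_uniq //.
  by move=> k; rewrite mem_filter in_fsetU; case: (k \in B).
rewrite addrAC subrr add0r; apply: in_pZ_sum => k kB; apply/in_pZMr/small.
by apply: contra kB; apply: (fsubsetP AB).
Qed.

(** The value lies within distance 1 of a partial sum, which is in Z_p. *)
Lemma mpeval_int phi x : (forall x, mpcvg phi (fun j => (x j)%:Qp)) ->
  exists y : Z, mpeval phi (fun j => (x j)%:Qp) = y%:Qp.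
Proof.
move=> /(mpeval_approx 0)[A /(_ A x (fsubset_refl A))]; rewrite expr0 invr1.
by move/pnorm_le1 => [y e]; exists (y + mpsum_int phi A x); rewrite rmorphD /= -e subrK.
Qed.

End MultivariateEvaluation.

(** * Polynomial functions and iteration of a map congruent to the identity modulo p *)

Section PolynomialFunctions.
Variables (p : nat) (p_pr : prime p) (n : nat).
Local Notation Z := (padic_int p_pr).
Implicit Types (h g : ('I_n -> Z) -> Z) (x y : 'I_n -> Z).

(** Generating polynomial functions by sums and products lets the effect of composition with a map
    be studied by structural induction. *)
Inductive polyfun : (('I_n -> Z) -> Z) -> Prop :=
| polyfun_const c : polyfun (fun=> c)
| polyfun_var j : polyfun (fun x => x j)
| polyfunD h g : polyfun h -> polyfun g -> polyfun (fun x => h x + g x)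
| polyfunM h g : polyfun h -> polyfun g -> polyfun (fun x => h x * g x).

Lemma polyfun_sum (I : Type) (r : seq I) (F : I -> ('I_n -> Z) -> Z) :
  (forall i, polyfun (F i)) -> polyfun (fun x => \sum_(i <- r) F i x).
Proof.
move=> hF; elim: r => [|i r IH].
  by rewrite (_ : (fun=> _) = fun=> 0); [constructor | apply/funext => x; rewrite big_nil].
rewrite (_ : (fun=> _) = fun x => F i x + \sum_(i <- r) F i x); first exact: polyfunD.
by apply/funext => x; rewrite big_cons.
Qed.

Lemma polyfun_prod (I : Type) (r : seq I) (F : I -> ('I_n -> Z) -> Z) :
  (forall i, polyfun (F i)) -> polyfun (fun x => \prod_(i <- r) F i x).
Proof.
move=> hF; elim: r => [|i r IH].
  by rewrite (_ : (fun=> _) = fun=> 1); [constructor | apply/funext => x; rewrite big_nil].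
rewrite (_ : (fun=> _) = fun x => F i x * \prod_(i <- r) F i x); first exact: polyfunM.
by apply/funext => x; rewrite big_cons.
Qed.

Lemma polyfunX h k : polyfun h -> polyfun (fun x => h x ^+ k).
Proof.
move=> ph; elim: k => [|k IH]; first exact: (polyfun_const 1).
rewrite (_ : (fun=> _) = fun x => h x * h x ^+ k); first exact: polyfunM.
by apply/funext => x; rewrite exprS.
Qed.

Lemma polyfun_mpsum (phi : mpseries p_pr n) A : polyfun (mpsum_int phi A).
Proof.
apply: polyfun_sum => k; apply: polyfunM; first exact: polyfun_const.
by apply: polyfun_prod => j; apply/polyfunX/polyfun_var.
Qed.

Lemma polyfun_lipschitz h m x y : polyfun h ->
  (forall j, in_pZ m (x j - y j)) -> in_pZ m (h x - h y).
Proof.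
move=> ph xy; elim: ph => {h} [c|j|h g _ ph _ pg|h g _ ph _ pg] //.
- by rewrite subrr; apply: in_pZ_0.
- by rewrite opprD addrACA; apply: in_pZD.
- apply: (@in_pZ_trans _ _ _ (h x * g y)).
    by rewrite -mulrBr; apply: in_pZMl.
  by rewrite -mulrBl; apply: in_pZMr.
Qed.

Variables (P : ('I_n -> Z) -> 'I_n -> Z) (G : 'I_n -> ('I_n -> Z) -> Z).
Hypotheses (polyG : forall j, polyfun (G j))
  (PE : forall x j, P x j = x j + p%:R * G j x).

Lemma polyfun_comp_diff h : polyfun h ->
  exists2 g, polyfun g & forall x, h (P x) - h x = p%:R * g x.
Proof.
move=> ph; elim: ph
  => {h} [c|j|h g ph [h' ph' eh] pg [g' pg' eg]|h g ph [h' ph' eh] pg [g' pg' eg]].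
- by exists (fun=> 0) => [|x]; [constructor | rewrite subrr mulr0].
- by exists (G j) => // x; rewrite PE addrAC subrr add0r.
- exists (fun x => h' x + g' x) => [|x]; first exact: polyfunD.
  by rewrite mulrDr -eh -eg opprD addrACA.
(* Discrete Leibniz rule: h(P) g(P) - h g = (h(P) - h) g(P) + h (g(P) - g), with g(P) rewritten as g
   + p g' so that the witness is visibly polynomial. *)
- exists (fun x => h' x * (g x + p%:R * g' x) + h x * g' x) => [|x].
    by do ?[exact: polyfun_const | apply: polyfunD | apply: polyfunM].
  rewrite -eg (addrC (g x)) subrK mulrDr mulrA -eh mulrCA -eg mulrBl mulrBr.
  by rewrite addrA subrK.
Qed.

(** Along an orbit of [P], a finite difference is the change under composition with [P], so each one
    releases a factor p and leaves a polynomial function. *)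
Lemma polyfun_iter_fdiff h w m : polyfun h ->
  exists2 g, polyfun g & forall j,
    iter m (@fdiff Z) (fun j => h (iter j P w)) j = p%:R ^+ m * g (iter j P w).
Proof.
move=> ph; elim: m => [|m [g pg eg]]; first by exists h => // j; rewrite mul1r.
have [g' pg' eg'] := polyfun_comp_diff pg; exists g' => // j.
by rewrite iterS /fdiff !eg -mulrBr iterS eg' mulrA -exprSr.
Qed.

End PolynomialFunctions.

Lemma iter_fdiff_pZ p (p_pr : prime p) m (u v : nat -> padic_int p_pr) k j :
  (forall j, in_pZ m (u j - v j)) ->
  in_pZ m (iter k (@fdiff (padic_int p_pr)) u j - iter k (@fdiff (padic_int p_pr)) v j).
Proof.
move=> uv; elim: k j => [|k IH] j //=; rewrite /fdiff opprD addrACA -opprD.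
by apply: in_pZD => //; apply: in_pZN.
Qed.

(** * The map defined by the power series and its orbits *)

Section IteratedMap.
Variables (n p : nat) (p_pr : prime p).
Local Notation Z := (padic_int p_pr).
Variable phi : 'I_n -> mpseries p_pr n.
Hypothesis phi_cvg : forall (i : 'I_n) (x : 'I_n -> Z), mpcvg (phi i) (fun j => (x j)%:Qp).
Hypothesis phi_modp : forall i k, in_pZ 1 (phi i k - mpvar p_pr i k).

Lemma mpsum_mpvar i (A : {fset multindex n}) (x : 'I_n -> Z) :
  [ffun j => nat_of_bool (j == i)] \in A -> mpsum_int (mpvar p_pr i) A x = x i.
Proof.
move=> iA; rewrite /mpsum_int (bigD1_seq _ iA) ?fset_uniq //= /mpvar eqxx mul1r.
rewrite [X in _ + X]big1 ?addr0; last by move=> k /negPf->; rewrite mul0r.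
rewrite (bigD1 i) //= ffunE eqxx expr1 big1 ?mulr1 // => j /negPf ji.
by rewrite ffunE ji expr0.
Qed.

Variable F : ('I_n -> Z) -> 'I_n -> Z.
Hypothesis FE : forall i x, mpeval (phi i) (fun j => (x j)%:Qp) = (F x i)%:Qp.

Lemma polyfun_approx m : exists (P : ('I_n -> Z) -> 'I_n -> Z) G,
  [/\ forall j, polyfun (G j), forall x j, P x j = x j + p%:R * G j x
    & forall x j, in_pZ m (F x j - P x j)].
Proof.
have /choice[G hG] i : exists g, polyfun g /\ forall x, in_pZ m (F x i - (x i + p%:R * g x)).
  have [A hA] := mpeval_approx m (@phi_cvg i).
  (* The exponent of the monomial x_i is included so that the partial sum over [B] splits exactly as
     x_i plus p times a polynomial function. *)
  pose B := ([ffun j => nat_of_bool (j == i)] |` A)%fset.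
  have /choice[b bE] := phi_modp i.
  exists (mpsum_int b B); split=> [|x]; first exact: polyfun_mpsum.
  apply/pnorm_le_pZ; rewrite rmorphB /= -FE; have := hA B x (fsubsetUr _ _).
  congr (is_true (pnorm (_ - _%:Qp) <= _)).
  rewrite -(@mpsum_mpvar i B x) ?fset1U1 // mulr_sumr -big_split /=.
  apply: eq_bigr => k _; rewrite mulrA -mulrDl; congr (_ * _).
  by rewrite -[p%:R]expr1 -bE addrC subrK.
exists (fun x j => x j + p%:R * G j x), G; split=> // [j|x j]; first by have [] := hG j.
by have [_] := hG j.
Qed.

(** Modulo p^m the map is polynomial with coefficients in Z_p, hence respects congruences. *)
Lemma map_lipschitz m x y j :
  (forall j, in_pZ m (x j - y j)) -> in_pZ m (F x j - F y j).
Proof.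
move=> xy; have [P [G [pG PE FP]]] := polyfun_approx m.
apply: in_pZ_trans (FP x j) _; apply: in_pZ_trans (in_pZC (FP y j)).
rewrite !PE; apply: (polyfun_lipschitz (h := fun x => x j + p%:R * G j x)) => //.
by do ?[exact: polyfun_const | exact: polyfun_var | apply: polyfunD | apply: polyfunM].
Qed.

Lemma orbit_fdiff_pZ w i m : in_pZ m (iter m (@fdiff Z) (fun j => iter j F w i) 0).
Proof.
have [P [G [pG PE FP]]] := polyfun_approx m.
have [g _ /(_ 0%N) eg] := polyfun_iter_fdiff pG PE w m (polyfun_var _ i).
(* [P] depends on m and only approximates [F]; the Lipschitz property keeps the two orbits congruent
   modulo p^m, and finite differences preserve this congruence. *)
have orb j k : in_pZ m (iter j F w k - iter j P w k).
  elim: j k => [|j IH] k; first by rewrite subrr; apply: in_pZ_0.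
  exact: in_pZ_trans (map_lipschitz k IH) (FP _ k).
have := iter_fdiff_pZ m 0 (orb ^~ i); rewrite eg => h.
by rewrite -[X in in_pZ m X](subrK (p%:R ^+ m * g w)); apply: in_pZD => //; exists (g w).
Qed.

End IteratedMap.

Theorem theorem3p4 (n p : nat) (n_gt0 : (0 < n)%N) (p_pr : prime p) (p_gt3 : (3 < p)%N)
    (phi : 'I_n -> mpseries p_pr n)
    (phi_cvg : forall (i : 'I_n) (x : 'I_n -> padic_int p_pr),
      mpcvg (phi i) (fun j => (x j)%:Qp))
    (phi_modp : forall (i : 'I_n) (k : multindex n), in_pZ 1 (phi i k - mpvar p_pr i k))
    (phi_coef : forall (i : 'I_n) (k : multindex n),
      (2 <= mdeg k)%N -> in_pZ (mdeg k - 1) (phi i k))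
    (omega : 'I_n -> padic_int p_pr) :
  exists f : 'I_n -> nat -> padic p_pr, forall i : 'I_n,
    [/\ forall z : padic p_pr, pnorm z <= 1 -> cvgn (padic_series (f i) z),
        padic_series_eval (f i) 0 = (omega i)%:Qp,
        forall z : padic p_pr, pnorm z <= 1 -> pnorm (padic_series_eval (f i) z) <= 1
      & forall z : padic p_pr, pnorm z <= 1 ->
          padic_series_eval (f i) (z + 1) = mpeval (phi i) (fun j => padic_series_eval (f j) z)].
Proof.
have /choice[F0 FE0] (ix : 'I_n * ('I_n -> padic_int p_pr)) :
    exists y : padic_int p_pr, mpeval (phi ix.1) (fun j => (ix.2 j)%:Qp) = y%:Qp.
  exact/mpeval_int/phi_cvg.
pose F x i := F0 (i, x); have FE i x : mpeval (phi i) (fun j => (x j)%:Qp) = (F x i)%:Qp.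
  exact: (FE0 (i, x)).
have /choice[f /choice[E fE]] i :=
  mahler_analytic (ltnW p_gt3) (orbit_fdiff_pZ phi_cvg phi_modp FE omega i).
have fcvg i z : padic_series (fun k => (f i k)%:Qp) z%:Qp @ \oo --> (E i z)%:Qp.
  by apply: padic_series_cvg; have [+ _ _] := fE i; apply.
have evalE i z : padic_series_eval (fun k => (f i k)%:Qp) z%:Qp = (E i z)%:Qp.
  exact/cvg_lim/fcvg/metric_hausdorff.
have lipE i m z w : in_pZ m (z - w) -> in_pZ m (E i z - E i w).
  by have [_ + _] := fE i; apply.
have E_nat i j : E i j%:R = iter j F omega i by have [_ _ ->] := fE i.
exists (fun i k => (f i k)%:Qp) => i; split=> [z /pnorm_le1[a ->]||z /pnorm_le1[a ->]|z /pnorm_le1[a ->]].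
- by apply/cvg_ex; exists (E i a)%:Qp; apply: fcvg.
- by rewrite -(rmorph0 (@padic_of_int p p_pr)) evalE (E_nat i 0%N).
- by apply/pnorm_le1; exists (E i a).
- rewrite -(rmorph1 (@padic_of_int p p_pr)) -rmorphD evalE.
  under [X in mpeval _ X]funext => j do rewrite evalE.
  rewrite FE; congr _%:Qp; apply/eqP; rewrite -subr_eq0; apply/eqP/in_pZ_eq0 => m.
  (* Density of N in Z_p: at a natural number j close to [a] the functional equation is the
     recursion of the orbit, and both sides move by at most p^-m between j and [a]. *)
  have [j aj] := padic_int_nat_approx m a.
  apply: (@in_pZ_trans _ _ _ (E i j.+1%:R)).
    by apply: lipE; rewrite -natr1 opprD addrACA subrr addr0.
  rewrite E_nat iterS; apply: (map_lipschitz phi_cvg phi_modp FE) => k.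
  by rewrite -E_nat; apply/lipE/in_pZC.
Qed.
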